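(* Let $F$ be an Archimedean Riesz space with an arbitrary truncation $\tau_F$, and let $q : F \to F/F_0(\tau_F)$ be the quotient map. For every Riesz space $E$ with a truncation $\tau_E$ and every truncation homomorphism $T : E \to F$, the composition $q \circ T$ is a Riesz homomorphism. Equivalently, $T(f \vee g) - T(f) \vee T(g) \in F_0(\tau_F)$ for all $f, g \in E$; and, in particular, $T(f)^{-} \in F_0(\tau_F)$ for all $f \in E^{+}$.
   Context: All Riesz spaces are real. A truncation on a Riesz space $E$ is a map $\tau : E^{+} \to E^{+}$ such that $\tau(f) \wedge g = f \wedge \tau(g)$ for all $f, g \in E^{+}$. The associated extended truncation is $\widetilde{\tau} : E \to E$, $\widetilde{\tau}(f) = \tau(f^{+}) - f^{-}$. A linear operator $T : E \to F$ between Riesz spaces with truncations $(E,\tau_E)$, $(F,\tau_F)$ is a truncation homomorphism if $T \circ \widetilde{\tau_E} = \widetilde{\tau_F} \circ T$. The set $F_0(\tau_F) = \{ g \in F : \tau_F(n|g|) = n|g| \text{ for all } n \in \mathbb{N} \}$ of truncation infinitesimal elements is a band of $F$, so $F/F_0(\tau_F)$ is a quotient Riesz space. *)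

(* Defs.v *)
From HB Require Import structures.
From mathcomp Require Import all_boot all_order all_algebra.
From mathcomp Require Import boolp reals.
Set Implicit Arguments.
Unset Strict Implicit.
Unset Printing Implicit Defensive.
Import Order.TTheory GRing.Theory Num.Theory.
Local Open Scope ring_scope.
Local Open Scope quotient_scope.

HB.mixin Record isRiesz (R : realType) E
    of GRing.Lmodule R E & Num.POrderedZmodule E := {
  riesz_meet : E -> E -> E;
  riesz_join : E -> E -> E;
  riesz_lexI : forall x y z : E,
    (x <= riesz_meet y z) = (x <= y) && (x <= z);
  riesz_leUx : forall x y z : E,
    (riesz_join x y <= z) = (x <= z) && (y <= z);
  riesz_leD2r : forall z x y : E, x <= y -> x + z <= y + z;
  riesz_leZ : forall (a : R) (x y : E), 0 <= a -> x <= y -> a *: x <= a *: y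
}.

#[short(type="rieszType")]
HB.structure Definition Riesz (R : realType) :=
  {E of GRing.Lmodule R E & Num.POrderedZmodule E & isRiesz R E}.

(* Order.Lattice cannot be a parent of Riesz: Num.RealDomain would then need
   missing joins.  The lattice structure is attached to the carrier instead. *)
HB.instance Definition _ (R : realType) (E : rieszType R) :=
  Order.POrder_MeetJoin_isLattice.Build ring_display (Riesz.sort E)
    (@riesz_lexI R E) (@riesz_leUx R E).

Arguments riesz_leD2r {R s} z {x y}.
Arguments riesz_leZ {R s a x y}.

Notation "f ∨ g" := (@Order.join ring_display _ f g)
  (at level 50, left associativity) : ring_scope.
Notation "f ∧ g" := (@Order.meet ring_display _ f g)
  (at level 48, left associativity) : ring_scope.

Definition riesz_pos (R : realType) (E : rieszType R) (f : E) : E := f ∨ 0.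
Definition riesz_neg (R : realType) (E : rieszType R) (f : E) : E := - f ∨ 0.
Definition riesz_abs (R : realType) (E : rieszType R) (f : E) : E := f ∨ - f.

Definition archimedean_riesz (R : realType) (E : rieszType R) : Prop :=
  forall f g : E, 0 <= f -> 0 <= g -> (forall n : nat, f *+ n <= g) -> f = 0.

Definition riesz_hom (R : realType) (E F : rieszType R) (T : E -> F) : Prop :=
  linear T /\ {morph T : f g / f ∨ g}.

Section RieszTheory.
Variables (R : realType) (E : rieszType R).
Implicit Types x y z a : E.

Lemma riesz_leD x y z a : x <= y -> z <= a -> x + z <= y + a.
Proof.
move=> xy za; apply: le_trans (riesz_leD2r z xy) _.
by rewrite ![y + _]addrC; apply: riesz_leD2r.
Qed.

Lemma riesz_subr_ge0 x y : (0 <= y - x) = (x <= y).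
Proof.
apply/idP/idP => [/(riesz_leD2r x)|/(riesz_leD2r (- x))].
  by rewrite add0r subrK.
by rewrite subrr.
Qed.

Lemma riesz_leBl x y z : (x - z <= y) = (x <= y + z).
Proof.
by rewrite -[LHS]riesz_subr_ge0 -[RHS]riesz_subr_ge0 opprB addrA addrAC.
Qed.

Lemma riesz_oppr_le0 x : (- x <= 0) = (0 <= x).
Proof. by rewrite -riesz_subr_ge0 opprK add0r. Qed.

Lemma riesz_le_abs x : x <= riesz_abs x.
Proof. exact: leUl. Qed.

Lemma riesz_leN_abs x : - x <= riesz_abs x.
Proof. exact: leUr. Qed.

Lemma riesz_abs_le x a : (riesz_abs x <= a) = (x <= a) && (- x <= a).
Proof. exact: leUx. Qed.

Lemma riesz_abs_ge0 x : 0 <= riesz_abs x.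
Proof.
have := riesz_leD (riesz_le_abs x) (riesz_leN_abs x); rewrite subrr => h.
have /riesz_leZ/(_ h) : 0 <= 2^-1 :> R by rewrite invr_ge0.
by rewrite scaler0 -mulr2n -scaler_nat scalerA mulVf ?pnatr_eq0 // scale1r.
Qed.

Lemma riesz_ge0_abs x : 0 <= x -> riesz_abs x = x.
Proof.
move=> x0; apply: join_l; apply: le_trans (x0).
by rewrite riesz_oppr_le0.
Qed.

Lemma riesz_mulrn_ge0 x n : 0 <= x -> 0 <= x *+ n.
Proof.
move=> x0; rewrite -scaler_nat -(scaler0 _ n%:R).
by apply: riesz_leZ => //; exact: ler0n.
Qed.

Lemma riesz_lepMn2r x y n : x <= y -> x *+ n <= y *+ n.
Proof. by move=> xy; rewrite -!scaler_nat riesz_leZ. Qed.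

Lemma riesz_le_half x y : x *+ 2 <= y *+ 2 -> x <= y.
Proof.
rewrite -!scaler_nat => /(@riesz_leZ R E 2^-1); rewrite !scalerA.
by rewrite mulVf ?pnatr_eq0 // !scale1r; apply; rewrite invr_ge0.
Qed.

Lemma riesz_absD x y : riesz_abs (x + y) <= riesz_abs x + riesz_abs y.
Proof.
by rewrite riesz_abs_le opprD !riesz_leD ?riesz_le_abs ?riesz_leN_abs.
Qed.

Lemma riesz_absZ (c : R) x : riesz_abs (c *: x) <= `|c| *: riesz_abs x.
Proof.
rewrite riesz_abs_le; have [c0|/ltW c0] := leP 0 c.
  by rewrite ger0_norm // -scalerN !riesz_leZ ?riesz_le_abs ?riesz_leN_abs.
have -> : c *: x = - c *: - x by rewrite scaleNr scalerN opprK.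
rewrite ler0_norm // -scalerN opprK.
by rewrite !riesz_leZ ?oppr_ge0 ?riesz_le_abs ?riesz_leN_abs.
Qed.

End RieszTheory.

Definition solid (R : realType) (E : rieszType R) (S : {pred E}) : Prop :=
  forall x y : E, y \in S -> riesz_abs x <= riesz_abs y -> x \in S.

Record rieszIdeal (R : realType) (E : rieszType R) := RieszIdeal {
  ideal_pred :> {pred E};
  ideal_submod : GRing.submod_closed ideal_pred;
  ideal_solid : solid ideal_pred
}.

HB.instance Definition _ (R : realType) (E : rieszType R) (I : rieszIdeal E) :=
  GRing.isSubmodClosed.Build R E (ideal_pred I) (GRing.submod_closed_semi (@ideal_submod R E I)).

(* The quotient vector space E / I, ordered by [x] <= [y] iff some
   representatives of the two classes are comparable in E. *)
Section RieszQuotient.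
Variables (R : realType) (E : rieszType R) (I : rieszIdeal E).

Definition riesz_quot : Type := Quotient.quot (ideal_pred I).
HB.instance Definition _ := GRing.Zmodule.on riesz_quot.

Definition riesz_proj (x : E) : riesz_quot := \pi_(Quotient.quot (ideal_pred I)) x.

Lemma riesz_proj_eq x y : riesz_proj x = riesz_proj y <-> x - y \in I.
Proof. by rewrite Quotient.idealrBE; split=> [xy|/eqP]; first exact/eqP. Qed.

Lemma riesz_proj_repr (X : riesz_quot) :
  riesz_proj (repr (X : Quotient.quot (ideal_pred I))) = X.
Proof. exact: reprK. Qed.

Lemma riesz_projP (X : riesz_quot) : exists x, riesz_proj x = X.
Proof. by exists (repr (X : Quotient.quot (ideal_pred I))); exact: riesz_proj_repr. Qed.

Lemma riesz_projD x y : riesz_proj (x + y) = riesz_proj x + riesz_proj y.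
Proof. exact: (raddfD (\pi_(Quotient.quot (ideal_pred I)))). Qed.

Definition quot_scale (a : R) (X : riesz_quot) : riesz_quot :=
  riesz_proj (a *: repr (X : Quotient.quot (ideal_pred I))).

Lemma riesz_projZ a x : riesz_proj (a *: x) = quot_scale a (riesz_proj x).
Proof.
apply/riesz_proj_eq; rewrite -scalerBr rpredZ //.
by apply/riesz_proj_eq; rewrite riesz_proj_repr.
Qed.

Fact quot_scaleA a b X : quot_scale a (quot_scale b X) = quot_scale (a * b) X.
Proof.
by case: (riesz_projP X) => x <-; rewrite -!riesz_projZ scalerA.
Qed.
Fact quot_scale1 : left_id 1 quot_scale.
Proof. by move=> X; case: (riesz_projP X) => x <-; rewrite -riesz_projZ scale1r. Qed.
Fact quot_scaleDr : right_distributive quot_scale +%R.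
Proof.
move=> a X Y; case: (riesz_projP X) (riesz_projP Y) => x <- [y <-].
by rewrite -riesz_projD -!riesz_projZ scalerDr riesz_projD.
Qed.
Fact quot_scaleDl X : {morph quot_scale^~ X : a b / a + b}.
Proof.
move=> a b; case: (riesz_projP X) => x <-.
by rewrite -!riesz_projZ scalerDl riesz_projD.
Qed.
HB.instance Definition _ := GRing.Zmodule_isLmodule.Build R riesz_quot
  quot_scaleA quot_scale1 quot_scaleDr quot_scaleDl.

Definition quot_le (X Y : riesz_quot) : bool :=
  `[< exists x y, [/\ riesz_proj x = X, riesz_proj y = Y & x <= y] >].

Lemma solidP (x a : E) : a \in I -> x <= a -> - x <= a -> x \in I.
Proof.
move=> Ia xa Nxa; apply: (@ideal_solid _ _ I _ _ Ia) _.
by apply: le_trans (riesz_le_abs a); rewrite riesz_abs_le xa.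
Qed.

Lemma ideal_abs x : x \in I -> riesz_abs x \in I.
Proof.
move=> Ix; apply: (@ideal_solid _ _ I _ _ Ix) _.
by rewrite riesz_ge0_abs // riesz_abs_ge0.
Qed.

Fact quot_le_refl : reflexive quot_le.
Proof.
by move=> X; case: (riesz_projP X) => x <-; apply/asboolP; exists x, x.
Qed.

Fact quot_le_anti : antisymmetric quot_le.
Proof.
move=> X Y /andP[/asboolP[x [y [<- <- xy]]] /asboolP[y' [x' [yy' xx' yx]]]].
apply/riesz_proj_eq.
have Iu : (y - y') + (x' - x) \in I by apply: rpredD; apply/riesz_proj_eq.
have ux : 0 <= riesz_abs ((y - y') + (x' - x)) by exact: riesz_abs_ge0.
apply: (solidP (ideal_abs Iu)).
  by apply: le_trans ux; rewrite riesz_leBl add0r.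
apply: le_trans (riesz_le_abs _); rewrite opprB addrA.
apply: (@riesz_leD2r R E (- x)); rewrite -addrA.
rewrite -{1}[y]addr0; apply: riesz_leD => //.
by rewrite addrC riesz_subr_ge0.
Qed.

Fact quot_le_trans : transitive quot_le.
Proof.
move=> Y X Z /asboolP[x [y [<- <- xy]]] /asboolP[y' [z [yy' <- yz]]].
apply/asboolP; exists x, (z + (y - y')); split => //.
  by apply/riesz_proj_eq; rewrite addrAC subrr add0r; apply/riesz_proj_eq.
by apply: le_trans xy _; rewrite addrCA -{1}[y]addr0 riesz_leD // riesz_subr_ge0.
Qed.

HB.instance Definition _ := Order.Le_isPOrder.Build ring_display riesz_quot
  quot_le_refl quot_le_anti quot_le_trans.

Definition quot_join (X Y : riesz_quot) : riesz_quot :=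
  riesz_proj (repr (X : Quotient.quot (ideal_pred I)) ∨ repr (Y : Quotient.quot (ideal_pred I))).
Definition quot_meet (X Y : riesz_quot) : riesz_quot :=
  riesz_proj (repr (X : Quotient.quot (ideal_pred I)) ∧ repr (Y : Quotient.quot (ideal_pred I))).

Lemma quot_op_morph (op : E -> E -> E) :
  (forall x y x' y' w, x <= x' + w -> y <= y' + w -> op x y <= op x' y' + w) ->
  forall x y x' y', riesz_proj x = riesz_proj x' ->
  riesz_proj y = riesz_proj y' -> riesz_proj (op x y) = riesz_proj (op x' y').
Proof.
move=> opP x y x' y' /riesz_proj_eq xx' /riesz_proj_eq yy'.
apply/riesz_proj_eq.
set w := riesz_abs (x - x') + riesz_abs (y - y').
have Iw : w \in I by apply: rpredD; apply: ideal_abs.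
have wx : riesz_abs (x - x') <= w.
  by rewrite -[leLHS]addr0 riesz_leD // riesz_abs_ge0.
have wy : riesz_abs (y - y') <= w.
  by rewrite -[leLHS]add0r riesz_leD // riesz_abs_ge0.
have bound u v : riesz_abs (u - v) <= w -> u <= v + w /\ v <= u + w.
  move=> uvw; split; rewrite addrC -riesz_leBl; apply: le_trans uvw.
    exact: riesz_le_abs.
  by rewrite -opprB riesz_leN_abs.
have [[xw x'w] [yw y'w]] := (bound _ _ wx, bound _ _ wy).
apply: (solidP Iw); rewrite ?opprB riesz_leBl addrC; exact: opP.
Qed.

Lemma riesz_projU x y :
  quot_join (riesz_proj x) (riesz_proj y) = riesz_proj (x ∨ y).
Proof.
apply: quot_op_morph; rewrite ?riesz_proj_repr //.
move=> a b a' b' w aw bw; rewrite leUx; apply/andP; split.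
  by apply: le_trans aw _; apply: riesz_leD2r; exact: leUl.
by apply: le_trans bw _; apply: riesz_leD2r; exact: leUr.
Qed.

Lemma riesz_projI x y :
  quot_meet (riesz_proj x) (riesz_proj y) = riesz_proj (x ∧ y).
Proof.
apply: quot_op_morph; rewrite ?riesz_proj_repr //.
move=> a b a' b' w aw bw; rewrite -riesz_leBl lexI !riesz_leBl.
apply/andP; split; first by apply: le_trans aw; exact: leIl.
by apply: le_trans bw; exact: leIr.
Qed.

Lemma riesz_proj_le x y : x <= y -> riesz_proj x <= riesz_proj y.
Proof. by move=> xy; apply/asboolP; exists x, y. Qed.

Fact quot_lexI X Y Z : (X <= quot_meet Y Z) = (X <= Y) && (X <= Z).
Proof.
apply/idP/andP => [|[]].
  case: (riesz_projP Y) (riesz_projP Z) => y <- [z <-]; rewrite riesz_projI.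
  move=> Xyz; split; apply: le_trans Xyz _; apply: riesz_proj_le.
    exact: leIl.
  exact: leIr.
move=> /asboolP[x [y [<- <- xy]]] /asboolP[x' [z [xx' <- xz]]].
have -> : riesz_proj x = riesz_proj (x ∧ x') by rewrite -riesz_projI xx' riesz_projI meetxx.
by rewrite riesz_projI riesz_proj_le // leI2.
Qed.

Fact quot_leUx X Y Z : (quot_join X Y <= Z) = (X <= Z) && (Y <= Z).
Proof.
apply/idP/andP => [|[]].
  case: (riesz_projP X) (riesz_projP Y) => x <- [y <-]; rewrite riesz_projU.
  move=> xyZ; split; apply: le_trans xyZ; apply: riesz_proj_le.
    exact: leUl.
  exact: leUr.
move=> /asboolP[x [z [<- <- xz]]] /asboolP[y [z' [<- zz' yz]]].
have -> : riesz_proj z = riesz_proj (z ∨ z') by rewrite -riesz_projU zz' riesz_projU joinxx.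
by rewrite riesz_projU riesz_proj_le // leU2.
Qed.

Fact quot_leD2r (Z X Y : riesz_quot) : X <= Y -> X + Z <= Y + Z.
Proof.
case: (riesz_projP Z) => z <- /asboolP[x [y [<- <- xy]]].
by rewrite -!riesz_projD riesz_proj_le // riesz_leD2r.
Qed.

Fact quot_leZ (a : R) (X Y : riesz_quot) : 0 <= a -> X <= Y -> a *: X <= a *: Y.
Proof.
move=> a0 /asboolP[x [y [<- <- xy]]].
rewrite [leLHS](esym (riesz_projZ a x)) [leRHS](esym (riesz_projZ a y)).
by rewrite riesz_proj_le // riesz_leZ.
Qed.

HB.instance Definition _ := isRiesz.Build R riesz_quot
  quot_lexI quot_leUx quot_leD2r quot_leZ.

Lemma riesz_proj_hom : riesz_hom riesz_proj.
Proof.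
split=> [a x y|x y]; first by rewrite riesz_projD riesz_projZ.
by rewrite -riesz_projU.
Qed.

End RieszQuotient.

Arguments riesz_proj {R E} I x.

(* Only the values of a truncation on the positive cone are meaningful. *)
Record truncation (R : realType) (E : rieszType R) := Truncation {
  trunc_fun :> E -> E;
  trunc_ge0 : forall f, 0 <= f -> 0 <= trunc_fun f;
  truncP : forall f g, 0 <= f -> 0 <= g -> trunc_fun f ∧ g = f ∧ trunc_fun g
}.

Definition ext_trunc (R : realType) (E : rieszType R) (tau : truncation E)
  (f : E) : E := tau (riesz_pos f) - riesz_neg f.

Definition trunc_hom (R : realType) (E F : rieszType R)
    (tauE : truncation E) (tauF : truncation F) (T : E -> F) : Prop :=
  linear T /\ forall f, T (ext_trunc tauE f) = ext_trunc tauF (T f).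

Definition trunc_infinitesimal (R : realType) (F : rieszType R)
    (tauF : truncation F) : {pred F} :=
  fun g => `[< forall n : nat, tauF (riesz_abs g *+ n) = riesz_abs g *+ n >].

Section TruncInfinitesimal.
Variables (R : realType) (F : rieszType R) (tau : truncation F).
Local Notation F0 := (trunc_infinitesimal tau).

Lemma trunc_le f : 0 <= f -> tau f <= f.
Proof.
move=> f0; have t0 := trunc_ge0 tau f0.
by rewrite -[tau f]meetxx (truncP tau f0 t0) leIl.
Qed.

Lemma trunc_fix_le f g : 0 <= f -> f <= g -> tau g = g -> tau f = f.
Proof.
move=> f0 fg tg; have g0 := le_trans f0 fg.
have := truncP tau f0 g0; rewrite tg (meet_idPl fg) => e.
by rewrite -[RHS]e (meet_idPl _) // (le_trans (trunc_le f0)).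
Qed.

Lemma trunc_fix_join f g : 0 <= f -> 0 <= g ->
  tau f = f -> tau g = g -> tau (f ∨ g) = f ∨ g.
Proof.
move=> f0 g0 tf tg; have fg0 : 0 <= f ∨ g by apply: le_trans f0 _; exact: leUl.
apply/le_anti; rewrite trunc_le //= leUx; apply/andP; split.
  have := truncP tau f0 fg0; rewrite tf (meet_idPl (leUl _ _)) => e.
  by rewrite [leLHS]e leIr.
have := truncP tau g0 fg0; rewrite tg (meet_idPl (leUr _ _)) => e.
by rewrite [leLHS]e leIr.
Qed.

Fact trunc_infinitesimal_solid : solid F0.
Proof.
move=> x y /asboolP Fy xy; apply/asboolP => n; apply: trunc_fix_le (Fy n).
  by rewrite riesz_mulrn_ge0 // riesz_abs_ge0.
exact: riesz_lepMn2r.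
Qed.

Fact trunc_infinitesimal_submod : GRing.subsemimod_closed F0.
Proof.
split; first split.
- apply/asboolP => n; rewrite riesz_ge0_abs // mul0rn.
  by apply/le_anti; rewrite trunc_le //= trunc_ge0.
- move=> x y /asboolP Fx /asboolP Fy; apply/asboolP => n.
  have ax := riesz_abs_ge0 x; have ay := riesz_abs_ge0 y.
  set c := (riesz_abs x *+ (n * 2)) ∨ (riesz_abs y *+ (n * 2)).
  apply: (@trunc_fix_le _ c); first by rewrite riesz_mulrn_ge0 // riesz_abs_ge0.
    have xyc : (riesz_abs x + riesz_abs y) *+ n <= c.
      apply: riesz_le_half; rewrite -mulrnA mulrnDl mulr2n.
      by apply: riesz_leD; [exact: leUl|exact: leUr].
    apply: le_trans xyc; apply: riesz_lepMn2r; exact: riesz_absD.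
  by apply: trunc_fix_join; rewrite ?riesz_mulrn_ge0.
- move=> a x /asboolP Fx; apply/asboolP => n.
  apply: (trunc_fix_le _ _ (Fx (Num.bound `|a| * n)%N)).
    by rewrite riesz_mulrn_ge0 // riesz_abs_ge0.
  rewrite mulrnA; apply: riesz_lepMn2r.
  apply: le_trans (riesz_absZ a x) _.
  rewrite -scaler_nat -riesz_subr_ge0 -scalerBl.
  rewrite -(scaler0 _ ((Num.bound `|a|)%:R - `|a|)) riesz_leZ ?riesz_abs_ge0 //.
  by rewrite subr_ge0 ltW // archi_boundP.
Qed.

Definition trunc_inf_ideal : rieszIdeal F :=
  RieszIdeal (GRing.subsemimod_closed_submod trunc_infinitesimal_submod)
    trunc_infinitesimal_solid.

End TruncInfinitesimal.

(* Main.v *)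
From HB Require Import structures.
Require Import Defs.
From mathcomp Require Import all_boot all_order all_algebra.
From mathcomp Require Import boolp reals.
Import Order.TTheory GRing.Theory.
Local Open Scope ring_scope.

(** The extended truncation is the identity on the negative cone, so a
    truncation homomorphism T applied to [- f], with [f >= 0], shows that
    [(T f)^-] is fixed by the truncation of F ([trunc_hom_neg_fixed]).  The
    same holds for every multiple of [f], and a positive element all of whose
    multiples are fixed is infinitesimal: hence [(T f)^-] is infinitesimal.

    For joins, translation reduces the claim to [T (f^+) - (T f)^+].  Put
    [u = T (f^+)] and [v = T (f^-)], so that [T f = u - v] and the difference
    is [u ∧ v]: the question is whether T preserves disjointness up to
    infinitesimals.  Comparing the homomorphism property at [f] and at [f^+]
    gives

      [tau (u^+) = tau ((u - v)^+) + (u ∧ v + u^-)],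

    hence [w = u ∧ v + u^-] lies below [tau (u^+)]
    ([trunc_hom_disjoint_le]).  Positive elements below a value of a
    truncation are fixed by it ([trunc_fix_below]), so [w^+] is fixed, and by
    homogeneity it is infinitesimal.  On the other hand [w^- <= v^-], and
    [u^-], [v^-] are infinitesimal by the first part; so are [w] and
    [u ∧ v = w - u^-]. *)

(** * Riesz space identities *)

Section RieszIdentities.
Context {R : realType} {E : rieszType R}.
Implicit Types x y z : E.

Lemma riesz_joinDr x y z : (x ∨ y) + z = (x + z) ∨ (y + z).
Proof.
apply/le_anti/andP; split; last by rewrite leUx !riesz_leD2r ?leUl ?leUr.
have le_sub t s : (t <= s - z) = (t + z <= s) by rewrite -riesz_leBl opprK.
by rewrite -le_sub leUx !le_sub leUl leUr.
Qed.

Lemma riesz_joinE x y : x ∨ y = riesz_pos (x - y) + y.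
Proof. by rewrite riesz_joinDr subrK add0r. Qed.

Lemma riesz_le_opp x y : (- x <= - y) = (y <= x).
Proof. by rewrite -[LHS]riesz_subr_ge0 opprK addrC riesz_subr_ge0. Qed.

Lemma riesz_le_oppr x y : (x <= - y) = (y <= - x).
Proof. by rewrite -[RHS]riesz_le_opp opprK. Qed.

Lemma riesz_oppU x y : - (x ∨ y) = (- x) ∧ (- y).
Proof.
apply/le_anti/andP; split; first by rewrite lexI !riesz_le_opp leUl leUr.
by rewrite riesz_le_oppr leUx (riesz_le_oppr x) (riesz_le_oppr y) leIl leIr.
Qed.

Lemma riesz_meetDr x y z : (x ∧ y) + z = (x + z) ∧ (y + z).
Proof.
rewrite -[x]opprK -[y]opprK -riesz_oppU -[z]opprK -opprD riesz_joinDr riesz_oppU.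
by rewrite !opprD !opprK.
Qed.

Lemma riesz_subr_posB x y : x - riesz_pos (x - y) = x ∧ y.
Proof.
by rewrite riesz_oppU addrC riesz_meetDr opprB subrK oppr0 add0r meetC.
Qed.

Lemma riesz_negN x : riesz_neg (- x) = riesz_pos x.
Proof. by rewrite /riesz_neg opprK. Qed.

Lemma riesz_negB x y : riesz_neg (x - y) = riesz_pos (y - x).
Proof. by rewrite -riesz_negN opprB. Qed.

Lemma riesz_subr_pos x : riesz_pos x - x = riesz_neg x.
Proof. by rewrite riesz_joinDr subrr sub0r joinC. Qed.

Lemma riesz_posneg x : riesz_pos x - riesz_neg x = x.
Proof. by rewrite -riesz_subr_pos opprB addrC subrK. Qed.

Lemma riesz_pos_ge0 x : 0 <= riesz_pos x.
Proof. exact: leUr. Qed.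

Lemma riesz_neg_ge0 x : 0 <= riesz_neg x.
Proof. exact: leUr. Qed.

Lemma riesz_ge0_pos x : 0 <= x -> riesz_pos x = x.
Proof. exact: join_l. Qed.

Lemma riesz_ge0_neg x : 0 <= x -> riesz_neg x = 0.
Proof. by move=> x0; rewrite -riesz_subr_pos riesz_ge0_pos // subrr. Qed.

Lemma riesz_joinMn x y n : (x ∨ y) *+ n = (x *+ n) ∨ (y *+ n).
Proof.
case: n => [|n]; first by rewrite !mulr0n joinxx.
apply/le_anti/andP; split; last by rewrite leUx !riesz_lepMn2r ?leUl ?leUr.
have c0 : 0 <= n.+1%:R^-1 :> R by rewrite Num.Theory.invr_ge0 Num.Theory.ler0n.
have Kn z : n.+1%:R *: (n.+1%:R^-1 *: z) = z.
  by rewrite scalerA mulfV ?scale1r // Num.Theory.pnatr_eq0.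
have nK z : n.+1%:R^-1 *: (z *+ n.+1) = z.
  by rewrite -scaler_nat scalerA mulVf ?scale1r // Num.Theory.pnatr_eq0.
rewrite -[leRHS]Kn scaler_nat riesz_lepMn2r // leUx.
by rewrite -{1}(nK x) -{2}(nK y) !riesz_leZ ?leUl ?leUr.
Qed.

Lemma riesz_meetMn x y n : (x ∧ y) *+ n = (x *+ n) ∧ (y *+ n).
Proof.
rewrite -[x]opprK -[y]opprK -riesz_oppU !mulNrn riesz_joinMn riesz_oppU.
by rewrite !mulNrn.
Qed.

Lemma riesz_posMn x n : riesz_pos x *+ n = riesz_pos (x *+ n).
Proof. by rewrite /riesz_pos riesz_joinMn mul0rn. Qed.

Lemma riesz_negMn x n : riesz_neg x *+ n = riesz_neg (x *+ n).
Proof. by rewrite /riesz_neg riesz_joinMn mul0rn mulNrn. Qed.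

End RieszIdentities.

(** * Fixed and infinitesimal elements of a truncation *)

Section TruncationFixed.
Context {R : realType} {F : rieszType R} (tau : truncation F).
Local Notation F0 := (trunc_infinitesimal tau).

Lemma trunc0 : tau 0 = 0.
Proof. by apply/le_anti; rewrite trunc_le //= trunc_ge0. Qed.

(** The truncation identity turns [y = tau x ∧ y] into [y = x ∧ tau y]. *)
Lemma trunc_fix_below x y : 0 <= x -> 0 <= y -> y <= tau x -> tau y = y.
Proof.
move=> x0 y0 yx; apply/le_anti; rewrite trunc_le //=.
by have := truncP tau x0 y0; rewrite (meet_idPr yx) => {1}->; exact: leIr.
Qed.

Lemma trunc_infinitesimal_ge0 x :
  0 <= x -> (forall n, tau (x *+ n) = x *+ n) -> x \in F0.
Proof.
by move=> x0 fix_x; apply/asboolP => n; rewrite riesz_ge0_abs // fix_x.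
Qed.

Lemma trunc_infinitesimalB x y : x \in F0 -> y \in F0 -> x - y \in F0.
Proof. exact: (@rpredB _ (trunc_inf_ideal tau)). Qed.

Lemma trunc_infinitesimal_le x y : 0 <= x -> x <= y -> y \in F0 -> x \in F0.
Proof.
move=> x0 xy Fy; apply: (trunc_infinitesimal_solid Fy).
by rewrite !riesz_ge0_abs // (le_trans x0).
Qed.

End TruncationFixed.

(** * Truncation homomorphisms *)

Section TruncationHomomorphism.
Context {R : realType} {E F : rieszType R}.
Context {tauE : truncation E} {tauF : truncation F} (T : {linear E -> F}).
Hypothesis T_trunc : forall f, T (ext_trunc tauE f) = ext_trunc tauF (T f).
Local Notation F0 := (trunc_infinitesimal tauF).
Implicit Types f g : E.

(** Both extended truncations are evaluated at [- f], where the one of E is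
    the identity. *)
Lemma trunc_hom_neg_fixed f :
  0 <= f -> tauF (riesz_neg (T f)) = riesz_neg (T f).
Proof.
move=> f0; have := T_trunc (- f).
rewrite /ext_trunc riesz_negN -/(riesz_neg f) (riesz_ge0_pos _ f0).
rewrite [riesz_pos (- f)](riesz_ge0_neg _ f0) trunc0 sub0r.
rewrite raddfN riesz_negN -/(riesz_neg _) => eT.
by rewrite -[RHS]riesz_subr_pos eT addrC subrK.
Qed.

Lemma trunc_hom_neg_infinitesimal f : 0 <= f -> riesz_neg (T f) \in F0.
Proof.
move=> f0; apply: (trunc_infinitesimal_ge0 _ _ (riesz_neg_ge0 _)) => n.
by rewrite riesz_negMn -raddfMn trunc_hom_neg_fixed // riesz_mulrn_ge0.
Qed.

(** The homomorphism property at [f^+] expresses [T (tauE (f^+))] through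
    [T (f^+)]; at [f] it expresses the same element through [T f].  The left-hand
    side is what [tauF ((T (f^+))^+)] has in excess of [tauF ((T f)^+)], which
    is positive. *)
Lemma trunc_hom_disjoint_le f :
  T (riesz_pos f) ∧ T (riesz_neg f) + riesz_neg (T (riesz_pos f))
    <= tauF (riesz_pos (T (riesz_pos f))).
Proof.
set u := T (riesz_pos f); set v := T (riesz_neg f).
have Tf : T f = u - v by rewrite -raddfB riesz_posneg.
have Tfp : T (tauE (riesz_pos f)) = tauF (riesz_pos u) - riesz_neg u.
  have := T_trunc (riesz_pos f).
  rewrite /ext_trunc (riesz_ge0_pos _ (riesz_pos_ge0 f)).
  by rewrite (riesz_ge0_neg _ (riesz_pos_ge0 f)) subr0.
have := T_trunc f; rewrite /ext_trunc raddfB /= Tfp Tf -/v riesz_negB => eT.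
(* [v - (u - v)^- = u ∧ v], so equating both values of
   [T (tauE (f^+))] gives the identity. *)
have -> : tauF (riesz_pos u)
    = tauF (riesz_pos (u - v)) + (u ∧ v + riesz_neg u).
  rewrite [u ∧ v]meetC -riesz_subr_posB addrA [v - _]addrC addrA -eT.
  by rewrite !subrK.
by rewrite -[leLHS]add0r riesz_leD2r // trunc_ge0 // riesz_pos_ge0.
Qed.

(** The lower bound of [trunc_hom_disjoint_le] may fail to be positive, so it
    is split: its positive part is fixed together with all its multiples, and
    its negative part is dominated by [(T (f^-))^-], which is infinitesimal. *)
Lemma trunc_hom_disjoint f : T (riesz_pos f) ∧ T (riesz_neg f) \in F0.
Proof.
set u := T (riesz_pos f); set v := T (riesz_neg f).
set w := u ∧ v + riesz_neg u.
have Fu : riesz_neg u \in F0 by rewrite trunc_hom_neg_infinitesimal ?riesz_pos_ge0.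
have Fv : riesz_neg v \in F0 by rewrite trunc_hom_neg_infinitesimal ?riesz_neg_ge0.
(* Every multiple of [w] is the same expression formed from [f *+ n]. *)
have Fwp : riesz_pos w \in F0.
  apply: (trunc_infinitesimal_ge0 _ _ (riesz_pos_ge0 _)) => n.
  rewrite riesz_posMn mulrnDl riesz_meetMn riesz_negMn -!raddfMn /=.
  rewrite riesz_posMn riesz_negMn.
  apply: (trunc_fix_below _ _ _ (riesz_pos_ge0 (T (riesz_pos (f *+ n))))).
    exact: riesz_pos_ge0.
  by rewrite leUx trunc_hom_disjoint_le trunc_ge0 ?riesz_pos_ge0.
(* [w = u^+ ∧ (v + u^-)], and both members are at least [- v^-]. *)
have Fwn : riesz_neg w \in F0.
  apply: (trunc_infinitesimal_le _ _ _ (riesz_neg_ge0 _) _ Fv).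
  rewrite leUx riesz_neg_ge0 andbT -riesz_le_opp opprK.
  have Nv0 : - riesz_neg v <= 0 by rewrite riesz_oppr_le0 riesz_neg_ge0.
  rewrite /w riesz_meetDr -{1}(riesz_posneg u) subrK lexI.
  rewrite (le_trans Nv0 (riesz_pos_ge0 u)) /= -[leLHS]addr0.
  by rewrite riesz_leD ?riesz_neg_ge0 // -riesz_le_opp opprK leUl.
have -> : u ∧ v = riesz_pos w - riesz_neg w - riesz_neg u.
  by rewrite riesz_posneg addrK.
by rewrite !trunc_infinitesimalB.
Qed.

(** By translation the difference is [T (h^+) - (T h)^+] with [h = f - g], and
    as [T h = T (h^+) - T (h^-)] this is [T (h^+) ∧ T (h^-)]. *)
Lemma trunc_hom_join f g : T (f ∨ g) - (T f ∨ T g) \in F0.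
Proof.
rewrite !riesz_joinE raddfD opprD addrACA addrN addr0 -raddfB.
rewrite -{2}(riesz_posneg (f - g)) raddfB riesz_subr_posB.
exact: trunc_hom_disjoint.
Qed.

End TruncationHomomorphism.

Theorem corollary3p21 (R : realType) (F : rieszType R)
    (F_archi : archimedean_riesz F) (tauF : truncation F)
    (E : rieszType R) (tauE : truncation E)
    (T : E -> F) (T_hom : trunc_hom tauE tauF T) :
  let q : F -> riesz_quot (trunc_inf_ideal tauF) :=
    riesz_proj (trunc_inf_ideal tauF) in
  [/\ riesz_hom (q \o T),
      forall f g : E,
        T (f ∨ g) - (T f ∨ T g) \in trunc_infinitesimal tauF
    & forall f : E, 0 <= f -> riesz_neg (T f) \in trunc_infinitesimal tauF].
Proof.
case: T_hom => T_lin T_trunc q.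
pose linT : {linear E -> F} :=
  HB.pack T (GRing.isLinear.Build R E F *:%R T T_lin).
have T_join f g : T (f ∨ g) - (T f ∨ T g) \in trunc_infinitesimal tauF.
  exact: (trunc_hom_join linT T_trunc).
split=> //; last exact: (trunc_hom_neg_infinitesimal linT T_trunc).
have [q_lin q_join] := riesz_proj_hom (trunc_inf_ideal tauF).
split=> [a f g|f g] /=; first by rewrite T_lin; exact: q_lin.
by rewrite -q_join; apply/riesz_proj_eq; exact: T_join.
Qed.
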